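(* The set of quasisymmetric equivalence classes of metric spaces homeomorphic to the Menger curve is uncountable.
   Context: A homeomorphism $f:(X,d_X)\to(Y,d_Y)$ between metric spaces is quasisymmetric if there is an increasing function $\eta:[0,\infty)\to[0,\infty)$ such that $\frac{d_Y(f(x),f(y))}{d_Y(f(y),f(z))}\le \eta\left(\frac{d_X(x,y)}{d_X(y,z)}\right)$ for all triples of distinct points $x,y,z\in X$. Two metric spaces are quasisymmetrically equivalent if there is a quasisymmetric homeomorphism of one onto the other. The (standard) Menger curve is $\mathscr{M}=\bigcap_{m\ge 0}E_m\subset\mathbb{R}^3$, where $E_0=[0,1]^3$, and $E_{m+1}$ is obtained from $E_m$ (a union of triadic cubes of side length $3^{-m}$) by dividing each of these cubes into $27$ congruent subcubes of side length $3^{-m-1}$ and removing the central subcube and the $6$ subcubes meeting the middle squares of its faces (so that the $20$ subcubes meeting the one-dimensional edges of the cube are kept, and each $E_m$ is closed). *)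

(* Defs.v *)
From HB Require Import structures.
From mathcomp Require Import all_boot all_order all_algebra.
From mathcomp Require Import all_classical all_reals all_analysis.

Set Implicit Arguments.
Unset Strict Implicit.
Unset Printing Implicit Defensive.

Import Order.TTheory GRing.Theory Num.Theory.
Import numFieldNormedType.Exports.

Local Open Scope classical_set_scope.
Local Open Scope ring_scope.

Definition homeomorphism (S T : topologicalType) (f : S -> T) : Prop :=
  continuous f /\
  exists g : T -> S, [/\ cancel f g, cancel g f & continuous g].

Definition homeomorphic (S T : topologicalType) : Prop :=
  exists f : S -> T, homeomorphism f.

Section MengerCurve.
Variable R : realType.

(* The closed triadic cube of side 3^-m with lowest corner c / 3^m. *)
Definition triadic_cube (m : nat) (c : 'I_3 -> nat) : set 'rV[R]_3 :=
  [set x | forall i, (c i)%:R / 3 ^+ m <= x 0 i <= (c i).+1%:R / 3 ^+ m].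

(* Position of a subcube among the 27 = 3 * 3 * 3 ones. The central subcube is
   (1, 1, 1), and those in the middle of a face have exactly two coordinates
   equal to 1, so the 20 kept ones have at most one. *)
Definition kept_position (e : 'I_3 -> 'I_3) : bool :=
  (#|[set i | e i == 1%N :> nat]%SET| <= 1)%N.

Fixpoint menger_cubes (m : nat) : set ('I_3 -> nat) :=
  if m is m'.+1 then
    [set c' | exists c e, [/\ menger_cubes m' c, kept_position e
                            & forall i, c' i = (3 * c i + e i)%N]]
  else [set c | forall i, c i = 0%N].

Definition menger_stage (m : nat) : set 'rV[R]_3 :=
  \bigcup_(c in menger_cubes m) triadic_cube m c.

Definition menger_set : set 'rV[R]_3 := \bigcap_m menger_stage m.

Definition menger_curve : topologicalType := set_type menger_set.

End MengerCurve.

Section Quasisymmetry.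
Variable R : realType.

(* eta stands for a function [0, oo[ -> [0, oo[: only its values at nonnegative
   arguments are constrained, and used. *)
Definition quasisymmetric (X Y : metricType R) (f : X -> Y) : Prop :=
  homeomorphism f /\
  exists eta : R -> R,
    [/\ forall t, 0 <= t -> 0 <= eta t,
        forall s t, 0 <= s -> s < t -> eta s < eta t
      & forall x y z : X, x <> y -> y <> z -> x <> z ->
          mdist (f x) (f y) / mdist (f y) (f z) <=
            eta (mdist x y / mdist y z)].

Definition qs_equivalent (X Y : metricType R) : Prop :=
  exists f : X -> Y, quasisymmetric f.

Definition menger_space (X : metricType R) : Prop :=
  homeomorphic X (menger_curve R).

(* The types metricType R and metricType R -> Prop are too large, as to
   universes, for the library's set, hence the plain predicates here and in
   countable_collection.
   As eta is not required to tend to 0 at 0, qs_equivalent is reflexive and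
   transitive, but its symmetry may fail for spaces that are not doubling. Two
   classes are equal iff each of the two spaces is qs_equivalent to the
   other. *)
Definition qs_class (X : metricType R) : metricType R -> Prop :=
  fun Y => menger_space Y /\ qs_equivalent X Y.

Definition menger_qs_classes : (metricType R -> Prop) -> Prop :=
  fun C => exists X : metricType R, menger_space X /\ C = qs_class X.

End Quasisymmetry.

(* Same content as the library's countable, namely an injection into nat. *)
Definition countable_collection (T : Type) (P : T -> Prop) : Prop :=
  exists f : T -> nat, forall x y, P x -> P y -> f x = f y -> x = y.

(* Main.v *)
Require Import Defs.
From HB Require Import structures.
From mathcomp Require Import all_boot all_order all_algebra.
From mathcomp Require Import all_classical all_reals all_analysis.
From mathcomp Require Import lra zify.

(** The proof is a diagonal argument on packing numbers. If the classes were
    enumerated, choose a representative Y_n of each. It is compact, hence there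
    is a finite bound g n k on the number of points of Y_n that are pairwise
    k^-k apart. Let G k be the maximum of g n k over n <= k.

    Replace the distance |x - y| of the Menger set by gauge (|x - y|), where the
    gauge is subadditive, continuous at 0, and so steep there that the edge
    [0, 1] x {0} x {0} of the cube, which lies in the Menger set, contains more
    than G k points that are pairwise 2^-k apart, for every k. The resulting
    space X is still homeomorphic to the Menger curve (steep_menger_space).

    A quasisymmetric map f from X cannot shrink these configurations faster than
    exponentially. Indeed each point y of the edge has, for every l, a point w_l
    of the edge at distance exactly 2^-l, so that comparing w_l with w_(l+1)
    costs a fixed factor H given by eta 2. Hence all distances from f y are
    at most H^(k+2) times the distance from f y to f z, if z is at distance
    at least 2^-k from y (quasisymmetric_power). So the images of the G k + 1
    points are pairwise at least c H^-(k+2) apart for some c > 0, which exceeds k^-k for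
    some arbitrarily large k. Therefore f cannot take its values in any Y_n
    (steep_not_quasisymmetric), although X must be in the class of one of
    them. *)

Set Implicit Arguments.
Unset Strict Implicit.
Unset Printing Implicit Defensive.

Import Order.TTheory GRing.Theory Num.Theory.
Import numFieldNormedType.Exports.

Local Open Scope classical_set_scope.
Local Open Scope ring_scope.

(** * Steep gauges *)

(** Each slope is at least 2^k times all earlier ones, which makes the values
    of the gauge at the inverse slopes exact (gauge_mesh), and at least G k,
    which makes room on the edge for more than G k points at mutual distance at
    least 2^-k. *)
Fixpoint slope (G : nat -> nat) (k : nat) : nat :=
  if k is k'.+1 then (2 ^ k * slope G k' + G k)%N else (2 + G 0)%N.

Lemma slope_gt1 G k : (1 < slope G k)%N.
Proof.
elim: k => [|k IHk] /=; first by rewrite leq_addr.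
apply: leq_trans IHk _.
by rewrite (leq_trans _ (leq_addr _ _))// leq_pmull ?expn_gt0.
Qed.

Lemma leq_slope G k : (G k <= slope G k)%N.
Proof. by case: k => [|k] /=; rewrite leq_addl. Qed.

Lemma slope_lacunary G j k : (j < k)%N -> (2 ^ k * slope G j <= slope G k)%N.
Proof.
elim: k => // k IHk; rewrite ltnS leq_eqVlt => /orP[/eqP -> | jk] /=.
  exact: leq_addr.
rewrite (leq_trans _ (leq_addr _ _))// leq_mul2l (leq_trans _ (IHk jk)) ?orbT//.
by rewrite leq_pmull ?expn_gt0.
Qed.

Section Gauge.
Variables (R : realType) (G : nat -> nat).

Let term (t : R) (j : nat) : R := Num.min (2^-1 ^+ j) ((slope G j)%:R * t).

(** A supremum of truncated linear functions t |-> min (2^-j, slope j * t):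
    the truncations make it continuous at 0, and each term, hence the supremum,
    is subadditive, so that it turns metrics into metrics of the same topology,
    while the slopes make it as steep as desired near 0. *)
Definition gauge (t : R) : R := sup (range (term t)).

Let half_ge0 j : 0 <= 2^-1 ^+ j :> R.
Proof. by rewrite exprn_ge0// invr_ge0. Qed.

Let half_le i j : (i <= j)%N -> 2^-1 ^+ j <= 2^-1 ^+ i :> R.
Proof.
by move=> ij; apply: ler_wiXn2l; rewrite ?invr_ge0// invf_le1// ler1n.
Qed.

Let term_le1 t j : term t j <= 1.
Proof. by rewrite ge_min (half_le (leq0n j)). Qed.

Let slope_gt0 j : 0 < (slope G j)%:R :> R.
Proof. by rewrite ltr0n (ltn_trans _ (slope_gt1 G j)). Qed.

Let term_ge0 t j : 0 <= t -> 0 <= term t j.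
Proof. by move=> t0; rewrite le_min half_ge0 mulr_ge0// ler0n. Qed.

Let gauge_ge_term t j : term t j <= gauge t.
Proof.
apply: ub_le_sup; last by exists j.
by exists 1 => _ [i _ <-]; exact: term_le1.
Qed.

Let gauge_le t (b : R) : (forall j, term t j <= b) -> gauge t <= b.
Proof.
move=> tb; apply: ge_sup; first by exists (term t 0); exists 0%N.
by move=> _ [j _ <-]; exact: tb.
Qed.

Lemma gauge0 : gauge 0 = 0.
Proof.
apply/eqP; rewrite eq_le; apply/andP; split.
  by apply: gauge_le => j; rewrite /term mulr0 ge_min lexx orbT.
by apply: le_trans (gauge_ge_term 0 0); rewrite term_ge0.
Qed.

Lemma gauge_le1 t : gauge t <= 1.
Proof. by apply: gauge_le => j; exact: term_le1. Qed.

(** The term of index 0, whose slope is at least 1: small values of the gauge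
    come from small arguments only. *)
Lemma gauge_ge_min t : 0 <= t -> Num.min 1 t <= gauge t.
Proof.
move=> t0; apply: le_trans (gauge_ge_term t 0).
rewrite /term expr0 le_min ge_min lexx /= ge_min.
by rewrite ler_peMl ?orbT// ler1n ltnW// slope_gt1.
Qed.

Lemma ler_gauge s t : s <= t -> gauge s <= gauge t.
Proof.
move=> st; apply: gauge_le => j; apply: le_trans (gauge_ge_term t j).
by rewrite /term le_min !ge_min lexx /= ler_wpM2l ?orbT.
Qed.

(** It suffices to treat one truncated linear function: either one summand
    already reaches the truncation level, or none does and linearity applies. *)
Lemma gauge_subadd s t : 0 <= s -> 0 <= t -> gauge (s + t) <= gauge s + gauge t.
Proof.
move=> s0 t0; apply: gauge_le => j.
apply: le_trans (lerD (gauge_ge_term s j) (gauge_ge_term t j)).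
have := half_ge0 j; have := slope_gt0 j; rewrite /term.
set a := 2^-1 ^+ j; set m := _%:R => m0 a0.
have ms : 0 <= m * s by rewrite mulr_ge0// ltW.
have mt : 0 <= m * t by rewrite mulr_ge0// ltW.
rewrite mulrDr; case: (leP a (m * s)) => h1; case: (leP a (m * t)) => h2;
  rewrite ge_min; apply/orP; [left|left|left|right]; lra.
Qed.

Lemma gauge_ge_half k t : 1 <= (slope G k)%:R * t -> 2^-1 ^+ k <= gauge t.
Proof.
move=> h; apply: le_trans (gauge_ge_term t k).
by rewrite le_min lexx /= (le_trans _ h)// (half_le (leq0n k)).
Qed.

(** At the inverse k-th slope, the term k reaches its truncation level 2^-k;
    later terms are truncated below it, and earlier ones have slopes at least
    2^k times smaller. *)
Lemma gauge_mesh k : gauge (slope G k)%:R^-1 = 2^-1 ^+ k.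
Proof.
apply/eqP; rewrite eq_le; apply/andP; split; last first.
  by apply: gauge_ge_half; rewrite mulfV// lt0r_neq0.
apply: gauge_le => j; rewrite ge_min; have [kj|jk] := leqP k j.
  by rewrite half_le.
apply/orP; right; rewrite ler_pdivrMr// exprVn ler_pdivlMl ?exprn_gt0//.
by rewrite -natrX -natrM ler_nat slope_lacunary.
Qed.

Lemma gauge_lt_small (e : R) : 0 < e ->
  exists2 d, 0 < d & forall t, t < d -> gauge t < e.
Proof.
move=> e0; have [k ke] : exists k, 2^-1 ^+ k < e :> R.
  have /cvgrPdist_lt/(_ e e0)[k _ /(_ k (leqnn k))] :
      (fun k => 2^-1 ^+ k : R) @ \oo --> 0.
    by apply: cvg_expr; rewrite ger0_norm ?invr_ge0// invf_lt1// ltr1n.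
  by rewrite /= sub0r normrN ger0_norm// => ?; exists k.
exists (slope G k)%:R^-1; first by rewrite invr_gt0.
by move=> t /ltW/ler_gauge; rewrite gauge_mesh => /le_lt_trans; exact.
Qed.

End Gauge.

(** * The Menger curve with a steep metric *)

(** An alias of the Menger set in which G selects the metric. *)
Definition steep_menger (R : realType) (G : nat -> nat) : Type :=
  set_type (menger_set (R := R)).

Section SteepMetric.
Variables (R : realType) (G : nat -> nat).

HB.instance Definition _ := Choice.on (steep_menger R G).

Definition steep_dist (x y : steep_menger R G) : R :=
  gauge G `|set_val x - set_val y|.

Let steep_distxx x : steep_dist x x = 0.
Proof. by rewrite /steep_dist subrr normr0 gauge0. Qed.

Let steep_dist_positivity x y : steep_dist x y = 0 -> x = y.
Proof.
move=> xy0; apply: val_inj; apply/eqP; rewrite -subr_eq0 -normr_eq0.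
rewrite eq_le normr_ge0 andbT -[_ <= _]orFb.
have := gauge_ge_min G (normr_ge0 (set_val x - set_val y)).
by rewrite -/(steep_dist x y) xy0 ge_min real_leNgt// ltr01 /=.
Qed.

Let steep_dist_sym x y : steep_dist x y = steep_dist y x.
Proof. by rewrite /steep_dist distrC. Qed.

Let steep_dist_triangle y x z :
  steep_dist x z <= steep_dist x y + steep_dist y z.
Proof.
rewrite /steep_dist; apply: le_trans (gauge_subadd _ _ _) => //.
by rewrite ler_gauge// ler_distD.
Qed.

HB.instance Definition _ := isMetric.Build R (steep_menger R G)
  steep_distxx steep_dist_positivity steep_dist_sym steep_dist_triangle.

Lemma steep_distE (x y : steep_menger R G) :
  mdist x y = gauge G `|set_val x - set_val y|.
Proof. by []. Qed.

(** The identity is a homeomorphism onto the subspace topology, as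
    gauge (|x - y|) and |x - y| are small simultaneously. *)
Lemma steep_menger_space : menger_space (steep_menger R G : metricType R).
Proof.
exists (id : steep_menger R G -> menger_curve R); split; last first.
  exists (id : menger_curve R -> steep_menger R G); split=> //.
  move=> x; pose F := nbhs (x : menger_curve R).
  apply/(metricType_numDomainType.cvgrPdist_lt (F := F)) => e e0.
  have [d d0 dP] := gauge_lt_small G e0.
  have cval : continuous (set_val : menger_curve R -> 'rV[R]_3).
    exact: initial_continuous.
  have /(cvgrPdist_lt (F := F))/(_ d d0) := cval x.
  by apply: filterS => y; exact: dP.
apply: continuous_comp_initial => x.
apply/(cvgrPdist_lt (F := nbhs x)) => e e0.
have := metricType_numDomainType.cvgr_dist_lt (F := nbhs x) (f := id) cvg_id _.
move=> /(_ _ (Num.min 1 e)); rewrite lt_min ltr01 e0 => /(_ isT).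
apply: filterS => y; rewrite steep_distE.
move=> /(le_lt_trans (gauge_ge_min G (normr_ge0 _))).
rewrite lt_min !gt_min ltxx /= => /andP[xy1 /orP[|//]].
exact: lt_trans xy1.
Qed.

End SteepMetric.

(** * The Menger set: compactness and an edge *)

Section Menger.
Variable R : realType.

Lemma finite_menger_cubes m : finite_set (menger_cubes m).
Proof.
elim: m => [|m IHm] /=.
  apply: (sub_finite_set _ (finite_set1 (fun=> 0%N))) => c c0 /=.
  by apply/funext => i; exact: c0.
pose child (c : 'I_3 -> nat) (e : {ffun 'I_3 -> 'I_3}) i := (3 * c i + e i)%N.
apply: sub_finite_set (finite_image2 child IHm (@finite_finset _ setT)).
move=> c' [c [e [mc _ c'E]]]; exists c => //; exists (finfun e) => //.
by apply/funext => i; rewrite /child ffunE c'E.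
Qed.

Lemma closed_triadic_cube m c : closed (triadic_cube (R := R) m c).
Proof.
have -> : triadic_cube (R := R) m c = \bigcap_(i in [set: 'I_3])
    (fun x : 'rV[R]_3 => x 0 i) @^-1` `[(c i)%:R / 3 ^+ m, (c i).+1%:R / 3 ^+ m].
  apply/seteqP; split => [x cx i _|x cx i] /=.
    by rewrite in_itv /=; exact: cx.
  by have := cx i I; rewrite /= in_itv.
apply: closed_bigI => i _; apply: closed_comp; last exact: itv_closed.
by move=> x _; exact: coord_continuous.
Qed.

Lemma closed_menger_set : closed (menger_set (R := R)).
Proof.
apply: closed_bigI => m _.
apply: closed_bigcup; first exact: finite_menger_cubes.
by move=> c _; exact: closed_triadic_cube.
Qed.

Lemma bounded_menger_set : bounded_set (menger_set (R := R)).
Proof.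
exists 1; split=> // M M1 x /(_ 0%N I)[c c0 cx].
rewrite /Num.norm /= mx_normrE; apply/bigmax_leP; split => [|[i j] _ /=].
  by rewrite (le_trans ler01) ?ltW.
have := cx j; rewrite (c0 j) expr0 !divr1 (ord1 i) => /andP[x0 x1].
by rewrite ger0_norm// (le_trans x1)// ltW.
Qed.

(** A cluster point in the ambient space of the image of a filter on A, found
    in A by compactness, is a cluster point of the filter itself: the open sets
    of A are traces of ambient ones. *)
Lemma compact_set_type (T : topologicalType) (A : set T) :
  compact A -> compact [set: set_type A].
Proof.
move=> cA F FF _.
have [|p [Ap clp]] := cA (set_val @ F) (fmap_proper_filter _ FF).
  by rewrite /=; apply: filterS (@filterT _ F _) => x _; exact: set_valP.
exists (exist _ p (mem_set Ap)); split=> // S U FS [_ [[W oW <-]] /= Wp WU].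
have : (set_val @` S `&` W) !=set0.
  apply: clp; last exact: open_nbhs_nbhs.
  apply: (filterS (F := F) _ FS) => x Sx.
  by exists x.
by move=> [_ [[x Sx <-] Wx]]; exists x; split => //; exact: WU.
Qed.

Lemma compact_menger_curve : compact [set: menger_curve R].
Proof.
apply/compact_set_type/bounded_closed_compact.
  exact: bounded_menger_set.
exact: closed_menger_set.
Qed.

(** On the edge of the cube that the first axis carries, subcubes keep two
    coordinates equal to 0, so that at most one can be 1 and no position along
    the edge is ever removed. *)
Lemma menger_edge (s : R) : 0 <= s <= 1 -> menger_set (s *: delta_mx 0 0).
Proof.
move=> /andP[s0 s1] m _.
have [a [am sa mc]] : exists a : nat, [/\ (a < 3 ^ m)%N,
    a%:R / 3 ^+ m <= s <= a.+1%:R / 3 ^+ m &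
    menger_cubes m (fun i => if i == 0 then a else 0%N)].
  elim: m => [|m [a [am /andP[as1 as2] mc]]].
    by exists 0%N; rewrite expr0 mul0r divr1 s0 s1; split => // i /=; case: ifP.
  pose t := s * 3 ^+ m.+1.
  have p0 : 0 < 3 ^+ m :> R by rewrite exprn_gt0.
  (* d is the next ternary digit of s *)
  have [d [d3 td]] : exists d : nat, (d < 3)%N /\
      (3 * a + d)%:R <= t <= (3 * a + d).+1%:R.
    move: as1 as2; rewrite ler_pdivrMr// ler_pdivlMr// => h1 h2.
    have tE : t = 3 * (s * 3 ^+ m) by rewrite /t exprS mulrCA.
    move: h1 h2; rewrite -[a.+1%:R]natr1 => h1 h2.
    have childE d : (3 * a + d)%:R = 3 * a%:R + d%:R :> R.
      by rewrite natrD natrM.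
    case: (lerP t (3 * a%:R + 1)) => t1; [exists 0%N|
      case: (lerP t (3 * a%:R + 2)) => t2; [exists 1%N|exists 2%N]];
      by split=> //; apply/andP; rewrite -natr1 childE; split; lra.
  exists (3 * a + d)%N; split.
  - by rewrite expnS; lia.
  - by rewrite ler_pdivrMr ?exprn_gt0// ler_pdivlMr ?exprn_gt0.
  - pose e (i : 'I_3) : 'I_3 := if i == 0 then Ordinal d3 else 0.
    exists (fun i => if i == 0 then a else 0%N), e; split => //.
      rewrite /kept_position (leq_trans _ (eq_leq (cards1 (0 : 'I_3))))//.
      apply/subset_leq_card/fintype.subsetP => i; rewrite !inE /e.
      by case: (i == 0).
    by move=> i; rewrite /e; case: (i == 0) => //=; rewrite muln0.
exists (fun i => if i == 0 then a else 0%N) => // i.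
rewrite !mxE eqxx /=; case: (i == 0); first by rewrite mulr1.
by rewrite mulr0 mul0r lexx /= divr_ge0.
Qed.

Lemma norm_edge (s : R) : `|s *: delta_mx 0 0 : 'rV[R]_3| = `|s|.
Proof.
rewrite normrZ; suff -> : `|delta_mx 0 0 : 'rV[R]_3| = 1 by rewrite mulr1.
rewrite /Num.norm /= mx_normrE; apply/eqP; rewrite eq_le; apply/andP; split.
  apply/bigmax_leP; split=> [|[i j] _]; first exact: ler01.
  by rewrite /= mxE normr_nat; case: (_ && _).
by apply/bigmax_geP; right; exists (0, 0) => //=; rewrite mxE !eqxx normr1.
Qed.

Lemma menger_edge_isometry : exists g : R -> menger_curve R,
  forall s t, 0 <= s <= 1 -> 0 <= t <= 1 ->
  `|set_val (g s) - set_val (g t)| = `|s - t|.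
Proof.
have /choice[g gP] : forall s, exists p : menger_curve R, 0 <= s <= 1 ->
    set_val p = s *: delta_mx 0 0.
  move=> s; have [s01|s01] := boolP (0 <= s <= 1).
    pose p := mem_set (menger_edge s01).
    by exists (exist (fun x => x \in menger_set (R := R)) _ p).
  have m0 : menger_set (0 *: delta_mx 0 0 : 'rV[R]_3).
    by apply: menger_edge; rewrite lexx ler01.
  by exists (exist (fun x => x \in menger_set (R := R)) _ (mem_set m0)).
by exists g => s t s01 t01; rewrite !gP// -scalerBl norm_edge.
Qed.

End Menger.

(** * Packing numbers of compact metric spaces *)

(** An upper bound n on the sizes of the e-separated subsets of Y, the latter
    being enumerated by the first terms of a sequence. *)
Definition packing (R : realType) (Y : metricType R) (e : R) (n : nat) : Prop :=
  forall p : nat -> Y, exists i j, (i < j <= n)%N /\ mdist (p i) (p j) < e.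

Lemma packingW (R : realType) (Y : metricType R) (e : R) m n :
  (m <= n)%N -> packing Y e m -> packing Y e n.
Proof.
move=> mn pm p; have [i [j [/andP[ij jm] pij]]] := pm p.
by exists i, j; rewrite ij (leq_trans jm mn).
Qed.

Lemma compact_packing (R : realType) (Y : metricType R) (e : R) :
  compact [set: Y] -> 0 < e -> exists n, packing Y e n.
Proof.
move=> cY e0; have e20 : 0 < e / 2 by rewrite divr_gt0.
(* A finite (e / 2)-net comes from the covering form of compactness, along the
   filter of the finite lists that contain any given points. *)
pose above (s : seq Y) : set (seq Y) := [set s' : seq Y | {subset s <= s'}].
have aboveF : Filter (filter_from [set: seq Y] above).
  apply: filter_fromT_filter; first by exists [::].
  move=> s s'; exists (s ++ s') => r /= rP.
  by split => y ys; apply: rP; rewrite mem_cat ys ?orbT.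
have /compact_near_coveringP := cY.
pose near_list (s : seq Y) y := exists2 c, c \in s & mdist c y < e / 2.
move=> /(_ _ _ near_list aboveF) [].
  move=> y _; exists (ball y (e / 2), above [:: y]) => /=.
    by split; [exact: nbhsx_ballx|exists [:: y]].
  move=> [z s] /= [+ ys]; rewrite ballEmdist /= => yz; exists y => //.
  by apply: ys; rewrite inE.
move=> s _ /(_ s) sP; exists (size s) => p.
have /choice[c cP] : forall i, exists y, y \in s /\ mdist y (p i) < e / 2.
  by move=> i; have [|y ys yp] := sP _ (p i) I; [|exists y].
have : ~~ uniq (map c (iota 0 (size s).+1)).
  apply/negP => /uniq_leq_size; rewrite size_map size_iota => /(_ s).
  by rewrite ltnn => H; apply/notF/H => _ /mapP[i _ ->]; exact: (cP i).1.
move=> /(uniqPn (c 0%N))[i [j []]]; rewrite size_map size_iota => ij js.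
have is_ := ltn_trans ij js.
rewrite !(nth_map 0%N) ?size_iota// !nth_iota// !add0n => cij.
exists i, j; rewrite ij -ltnS; split=> //.
rewrite [ltRHS]splitr (le_lt_trans (metric_triangle _ (c i) _))// ltrD//.
  by rewrite metric_sym; exact: (cP i).2.
by rewrite cij; exact: (cP j).2.
Qed.

(** * Distortion of quasisymmetric maps *)

Lemma qs_refl (R : realType) (X : metricType R) : qs_equivalent X X.
Proof.
exists id; split.
  by split; [exact: (fun _ => cvg_id)|exists id; split => // x; exact: cvg_id].
by exists id; split.
Qed.

Section Distortion.
Variables (R : realType) (X Y : metricType R) (f : X -> Y).
Hypothesis fqs : quasisymmetric f.

Lemma quasisymmetric_inj : injective f.
Proof. by case: fqs => -[_ [g [fK _ _]]] _; exact: can_inj fK. Qed.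

(** The bound eta 2 of the distortion, as a constant that covers degenerate
    triples too. *)
Lemma quasisymmetric_doubling : exists H : nat, forall y x z : X, y <> z ->
  mdist y x <= 2 * mdist y z -> mdist (f y) (f x) <= H%:R * mdist (f y) (f z).
Proof.
have [_ [eta [eta0 etaS etaP]]] := fqs.
exists (Num.truncn (eta 2)).+2 => y x z yz yxz.
set H := _%:R; have H1 : 1 <= H by rewrite ler1n.
have etaH : eta 2 <= H.
  apply/ltW/(lt_le_trans (truncnS_gt (eta 2))).
  by rewrite ler_nat.
have [->|xy] := pselect (x = y).
  by rewrite mdistxx mulr_ge0// ?mdist_ge0// (le_trans ler01).
have [->|xz] := pselect (x = z); first by rewrite ler_peMl// mdist_ge0.
have yz0 : 0 < mdist y z by rewrite mdist_gt0; apply/eqP.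
have fyz0 : 0 < mdist (f y) (f z).
  by rewrite mdist_gt0; apply/eqP => /quasisymmetric_inj.
rewrite -ler_pdivrMr// metric_sym (le_trans (etaP _ _ _ xy yz xz))//.
rewrite (le_trans _ etaH)// metric_sym.
have : mdist y x / mdist y z <= 2 by rewrite ler_pdivrMr.
rewrite le_eqVlt => /orP[/eqP -> //|lt2].
by apply/ltW/etaS => //; rewrite divr_ge0 ?mdist_ge0.
Qed.

(** If points w l at distance exactly 2^-l of y exist at all scales, then going
    down from w 0 to w k costs the same factor H at each halving, so that the
    distortion is at most exponential in the number of scales, whatever the
    growth of eta: this leaves countably many rates to beat. *)
Lemma quasisymmetric_power : exists2 H : nat, (0 < H)%N &
  forall (y : X) (w : nat -> X), (forall x, mdist y x <= 1) ->
  (forall l, mdist y (w l) = 2^-1 ^+ l) ->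
  forall k z, 2^-1 ^+ k <= mdist y z ->
  forall x, mdist (f y) (f x) <= H%:R ^+ k.+2 * mdist (f y) (f z).
Proof.
have [H HP] := quasisymmetric_doubling.
exists H.+1 => // y w y1 yw k z kz x.
have H0 : 0 <= H.+1%:R :> R by [].
have dbl a b : 0 < mdist y b -> mdist y a <= 2 * mdist y b ->
    mdist (f y) (f a) <= H.+1%:R * mdist (f y) (f b).
  rewrite mdist_gt0 => /eqP yb /(HP _ _ _ yb) /le_trans; apply.
  by rewrite ler_wpM2r ?mdist_ge0// ler_nat.
have half0 l : 0 < 2^-1 ^+ l :> R by rewrite exprn_gt0// invr_gt0.
have zoom l : mdist (f y) (f x) <= H.+1%:R ^+ l.+1 * mdist (f y) (f (w l)).
  elim: l => [|l IHl].
    by rewrite expr1 dbl ?yw// expr0 mulr1 (le_trans (y1 x))// ler1n.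
  rewrite (le_trans IHl)// [_ ^+ l.+2]exprSr -mulrA ler_wpM2l ?exprn_ge0//.
  by rewrite dbl ?yw// exprS mulrA mulfV// mul1r.
rewrite (le_trans (zoom k))// [_ ^+ k.+2]exprSr -mulrA ler_wpM2l ?exprn_ge0//.
rewrite dbl ?yw ?(lt_le_trans (half0 k))// (le_trans kz)//.
by rewrite ler_peMl ?mdist_ge0// ler1n.
Qed.

End Distortion.

(** * The diagonal argument *)

Section Diagonal.
Variable R : realType.

Lemma menger_space_packing (Y : metricType R) (e : R) :
  menger_space Y -> 0 < e -> exists n, packing Y e n.
Proof.
move=> [f [_ [g [fK _ cg]]]] e0; apply: compact_packing => //.
have -> : [set: Y] = g @` setT.
  by apply/seteqP; split => y _ //; exists (f y).
apply: continuous_compact (@compact_menger_curve R).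
exact: continuous_subspaceT.
Qed.

(** Beyond k = C H^3, each of the k factors of k^k pays for C H^3, and
    C^k H^(3k) >= C H^(k+2). *)
Lemma exp_lt_superexp (C H n : nat) : (0 < C)%N -> (0 < H)%N ->
  exists2 k, (n <= k)%N & (C * H ^ k.+2 <= k ^ k)%N.
Proof.
move=> C0 H0; pose k := (C * H ^ 3 * n.+1)%N.
have H30 : (0 < C * H ^ 3)%N by rewrite muln_gt0 C0 expn_gt0 H0.
exists k; first by rewrite (leq_trans (leqnSn n))// leq_pmull.
have k0 : (0 < k)%N by rewrite muln_gt0 H30.
apply: (@leq_trans ((C * H ^ 3) ^ k)); last first.
  by rewrite leq_exp2r// leq_pmulr.
rewrite expnMn -expnM leq_mul//; last by rewrite leq_pexp2l//; lia.
by rewrite -{1}(expn1 C) leq_pexp2l.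
Qed.

(** The points of the edge with coordinates i / slope k, for i <= slope k, are
    pairwise at distance at least 2^-k, and there are more than G k of them.
    Their images are at mutual distance at least D / (2 H^(k+2)), D being the
    distance between the images of the two end points. For some k >= n this
    exceeds 1 / k^k, so that the packing bound of Y fails at that scale. *)
Lemma steep_not_quasisymmetric (G : nat -> nat) (Y : metricType R)
    (f : steep_menger R G -> Y) (n : nat) :
  (forall k, (n <= k)%N -> packing Y ((k ^ k)%:R^-1) (G k)) ->
  ~ quasisymmetric f.
Proof.
move=> packY fqs; have [H H0 HP] := quasisymmetric_power fqs.
have [g gP] := menger_edge_isometry R.
pose e s : steep_menger R G := g s.
have edgeE s t : 0 <= s <= 1 -> 0 <= t <= 1 ->
    mdist (e s) (e t) = gauge G `|s - t|.
  by move=> s01 t01; rewrite steep_distE gP.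
have slope0 k : 0 < (slope G k)%:R :> R.
  by rewrite ltr0n (ltn_trans _ (slope_gt1 G k)).
have lower s t k : 0 <= s <= 1 -> 0 <= t <= 1 ->
    (slope G k)%:R^-1 <= `|s - t| ->
  forall x, mdist (f (e s)) (f x) <= H%:R ^+ k.+2 * mdist (f (e s)) (f (e t)).
  move=> s01 t01 st.
  (* since the inverse slopes are at most 1/2, one of the two directions stays
     on the edge *)
  pose w l := e (if s <= 2^-1 then s + (slope G l)%:R^-1
                 else s - (slope G l)%:R^-1).
  apply: (HP (e s) w) => [x|l|].
  - by rewrite steep_distE gauge_le1.
  - have : (slope G l)%:R^-1 <= 2^-1 :> R.
      by rewrite lef_pV2 ?posrE// ler_nat slope_gt1.
    have : 0 < (slope G l)%:R^-1 :> R by rewrite invr_gt0.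
    move: s01 => /andP[s0 s1] i0 i2.
    rewrite -(gauge_mesh R G l) /w edgeE ?s0//; last first.
      by case: ifPn; rewrite -?ltNge => ?; apply/andP; split; lra.
    congr gauge; case: ifP => _.
      by rewrite opprD addNKr normrN gtr0_norm.
    by rewrite opprB addrC subrK gtr0_norm.
  - by rewrite edgeE// gauge_ge_half// -ler_pdivrMl// mulr1.
pose D := mdist (f (e 0)) (f (e 1)).
have i0 : 0 <= (0 : R) <= 1 by rewrite lexx ler01.
have i1 : 0 <= (1 : R) <= 1 by rewrite lexx ler01.
have D0 : 0 < D.
  rewrite mdist_gt0; apply/eqP => /(quasisymmetric_inj fqs) /eqP.
  apply/negP; rewrite -mdist_gt0 edgeE// sub0r normrN normr1.
  by rewrite (lt_le_trans _ (gauge_ge_min G ler01))// minxx.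
pose C := (Num.truncn (2 / D)).+1.
have CD : 2 / D < C%:R by exact: truncnS_gt.
have [k nk Ck] := exp_lt_superexp n (ltn0Sn _ : (0 < C)%N) H0.
pose s i : R := i%:R / (slope G k)%:R.
have s01 i : (i <= slope G k)%N -> 0 <= s i <= 1.
  move=> ik; rewrite divr_ge0//= ler_pdivrMr// mul1r ler_nat//.
have [i [j [/andP[ij jG]]]] := packY k nk (fun i => f (e (s i))).
have jk := leq_trans jG (leq_slope G k).
have ik := leq_trans (ltnW ij) jk.
have st : (slope G k)%:R^-1 <= `|s i - s j|.
  rewrite distrC /s -mulrBl -natrB 1?ltnW// ger0_norm ?divr_ge0//.
  by rewrite ler_peMl ?invr_ge0 ?ler0n// ler1n subn_gt0.
have far := lower _ _ _ (s01 i ik) (s01 j jk) st.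
apply/negP; rewrite -leNgt.
have D2 : D <= 2 * (H%:R ^+ k.+2 * mdist (f (e (s i))) (f (e (s j)))).
  rewrite (le_trans (metric_triangle _ (f (e (s i))) _))//.
  by rewrite metric_sym [leRHS]mulr_natl mulr2n lerD.
have k0 : 0 < (k ^ k)%:R :> R.
  by rewrite ltr0n (leq_trans _ Ck)// muln_gt0 expn_gt0 H0.
move: D2 CD Ck; rewrite -(ler_nat R) natrM natrX.
set h := H%:R ^+ _; set d := mdist _ _; move=> D2.
rewrite ltr_pdivrMr// => CD Ck.
rewrite -[leLHS]mul1r ler_pdivrMr//.
have d0 : 0 <= d by exact: mdist_ge0.
have := ler_wpM2l d0 Ck.
have : C%:R * D <= C%:R * (2 * (h * d)) by rewrite ler_wpM2l.
lra.
Qed.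

(** Each space of a class has a quasisymmetric map onto any chosen
    representative Y of it, so that the packing bounds of Y alone can serve the
    whole class. *)
Lemma packing_table (c : (metricType R -> Prop) -> nat) :
  (forall C D, menger_qs_classes C -> menger_qs_classes D ->
    c C = c D -> C = D) ->
  exists g : nat -> nat -> nat, forall X : metricType R, menger_space X ->
    exists2 Y : metricType R, qs_equivalent X Y &
      forall k, packing Y (k ^ k)%:R^-1 (g (c (qs_class X)) k).
Proof.
move=> c_inj.
suff /choice[g gP] : forall n, exists g : nat -> nat, forall X : metricType R,
    menger_space X -> c (qs_class X) = n -> exists2 Y : metricType R,
    qs_equivalent X Y & forall k, packing Y (k ^ k)%:R^-1 (g k).
  by exists g => X mX; exact: (gP _ X mX erefl).
move=> n; have [[Y [mY cY]]|noY] := pselect (exists Y : metricType R,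
    menger_space Y /\ c (qs_class Y) = n); last first.
  by exists id => X mX cX; case: noY; exists X.
have kk0 k : 0 < (k ^ k)%:R^-1 :> R.
  by rewrite invr_gt0 ltr0n; case: k => // k; rewrite expn_gt0.
have /choice[g gP] := fun k => menger_space_packing mY (kk0 k).
exists g => X mX cX; exists Y => //.
have XY : qs_class X = qs_class Y.
  by apply: c_inj; [exists X|exists Y|rewrite cX cY].
have : qs_class Y Y by split => //; exact: qs_refl.
by rewrite -XY => -[].
Qed.

End Diagonal.

Theorem theorem1p2 (R : realType) : ~ countable_collection (menger_qs_classes (R := R)).
Proof.
move=> [c c_inj]; have [g gP] := packing_table c_inj.
(* G eventually dominates the packing bounds of each class in the enumeration *)
pose G k := \max_(n < k.+1) g n k.
pose X : metricType R := steep_menger R G.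
have [Y [f fqs] packY] := gP X (steep_menger_space R G).
apply: (steep_not_quasisymmetric (n := c (qs_class X)) _ fqs) => k ck.
apply: packingW (packY k).
exact: (leq_bigmax (Ordinal (ck : (c (qs_class X) < k.+1)%N))).
Qed.
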